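(* Let $Y \in V^n$ be a tuple of samples. If the group $G \subseteq \mathrm{GL}(V)$ is closed under non-zero scalar multiples, then the supremum of the log-likelihood $\ell_Y$ over $\mathcal{M}_G$ equals $$-\inf_{\lambda \in \mathbb{R}_{>0}}\left(\frac{\lambda}{n}\left(\inf_{h \in G_{\mathrm{SL}}^{\pm}} \| h \cdot Y\|^2\right) - \dim(V)\log\lambda\right).$$ The MLEs given $Y$, if they exist, are the matrices $\lambda h^{\mathsf T} h$, where $h$ minimizes $\|h\cdot Y\|$ under the action of $G_{\mathrm{SL}}^{\pm}$ on $V^n$, and $\lambda \in \mathbb{R}_{>0}$ is the unique value minimizing the outer infimum.
   Context: $V$ is a finite-dimensional real vector space, identified with $\mathbb{R}^m$, $m=\dim V$, by a fixed isomorphism, so that elements of $\mathrm{GL}(V)$ are invertible real $m\times m$ matrices. $G\subseteq \mathrm{GL}(V)$ is a subgroup; it is closed under non-zero scalar multiples if $cg\in G$ for all $g \in G$, $c\in\mathbb{R}\setminus\{0\}$. $G_{\mathrm{SL}}^{\pm}$ is the subgroup of all matrices in $G$ with determinant $\pm1$. The Gaussian group model given by $G$ is the set of concentration matrices $\mathcal{M}_G=\{g^{\mathsf T}g \mid g\in G\}$ (of mean zero Gaussians). For $Y=(Y_1,\dots,Y_n)\in V^n$, the log-likelihood is $\ell_Y(\Psi)=\log\det(\Psi)-\mathrm{tr}(\Psi S_Y)$ for $\Psi \in \mathcal{M}_G$, where $S_Y=\frac1n\sum_{i=1}^n Y_iY_i^{\mathsf T}$. A maximum likelihood estimate (MLE)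 given $Y$ is a matrix in $\mathcal{M}_G$ at which $\ell_Y$ attains its maximum over $\mathcal{M}_G$. The group $G$ acts on $V^n$ by $g\cdot Y=(gY_1,\dots,gY_n)$, and $\|\cdot\|$ is the Euclidean norm, so $\|g\cdot Y\|^2=\sum_{i=1}^n\|gY_i\|^2$. *)

(* Defs.v *)
From HB Require Import structures.
From mathcomp Require Import all_boot all_order all_algebra.
From mathcomp Require Import all_classical all_reals all_analysis.
Set Implicit Arguments.
Unset Strict Implicit.
Unset Printing Implicit Defensive.
Import Order.TTheory GRing.Theory Num.Theory.
Local Open Scope classical_set_scope.
Local Open Scope ring_scope.

(* Subgroups of GL_m(R); MathComp's 'GL_m[R] needs a finite R. *)
Record is_subgroup_GL (R : realType) (m : nat) (G : set 'M[R]_m) : Prop := {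
  subGL_unit : forall g, G g -> g \in unitmx;
  subGL_1 : G 1%:M;
  subGL_mul : forall g h, G g -> G h -> G (g *m h);
  subGL_inv : forall g, G g -> G (invmx g)
}.

Definition closed_nonzero_scaling (R : realType) (m : nat)
    (G : set 'M[R]_m) : Prop :=
  forall (c : R) (g : 'M[R]_m), c != 0 -> G g -> G (c *: g).

Definition SLpm (R : realType) (m : nat) (G : set 'M[R]_m) : set 'M[R]_m :=
  [set g | G g /\ (\det g = 1 \/ \det g = -1)].

Definition group_model (R : realType) (m : nat) (G : set 'M[R]_m) :
    set 'M[R]_m :=
  [set g^T *m g | g in G].

Definition sample_cov (R : realType) (m n : nat) (Y : 'I_n -> 'cV[R]_m) :
    'M[R]_m :=
  n%:R^-1 *: \sum_(i < n) (Y i *m (Y i)^T).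

Definition loglik (R : realType) (m n : nat) (Y : 'I_n -> 'cV[R]_m)
    (Psi : 'M[R]_m) : R :=
  ln (\det Psi) - \tr (Psi *m sample_cov Y).

Definition is_minimizer (R : realType) (T : Type) (A : set T) (f : T -> R)
    (x : T) : Prop :=
  A x /\ forall y, A y -> f x <= f y.

Definition is_maximizer (R : realType) (T : Type) (A : set T) (f : T -> R)
    (x : T) : Prop :=
  A x /\ forall y, A y -> f y <= f x.

Definition is_MLE (R : realType) (m n : nat) (G : set 'M[R]_m)
    (Y : 'I_n -> 'cV[R]_m) (Psi : 'M[R]_m) : Prop :=
  is_maximizer (group_model G) (loglik Y) Psi.

Definition act (R : realType) (m n : nat) (g : 'M[R]_m)
    (Y : 'I_n -> 'cV[R]_m) : 'I_n -> 'cV[R]_m :=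
  fun i => g *m Y i.

(* The library norm `|v| on matrices is the max norm, hence this definition. *)
Definition enorm (R : realType) (m n : nat) (Y : 'I_n -> 'cV[R]_m) : R :=
  Num.sqrt (\sum_(i < n) \sum_(j < m) (Y i j 0) ^+ 2).

(* The real-valued inf is the honest infimum here: when G is a subgroup the set
   contains enorm Y ^+ 2 and is bounded below by 0. *)
Definition inf_SLpm_norm2 (R : realType) (m n : nat) (G : set 'M[R]_m)
    (Y : 'I_n -> 'cV[R]_m) : R :=
  inf [set enorm (act h Y) ^+ 2 | h in SLpm G].

Definition outer_fun (R : realType) (m n : nat) (G : set 'M[R]_m)
    (Y : 'I_n -> 'cV[R]_m) (l : R) : R :=
  l / n%:R * inf_SLpm_norm2 G Y - m%:R * ln l.

(* Main.v *)
(* Dividing g in G by |det g|^(1/m) shows that the model consists of the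
   matrices l h^T h with l > 0 and h in G of determinant 1 or -1. At such a
   matrix the negated log-likelihood is (l/n) |h.Y|^2 - m log l. For fixed l
   this is an increasing function of |h.Y|^2, so minimizing first over h and
   then over l gives both the supremum and the MLEs. *)
Require Import Defs.
From HB Require Import structures.
From mathcomp Require Import all_boot all_order all_algebra.
From mathcomp Require Import all_classical all_reals all_analysis.
From mathcomp Require Import lra.
Import Order.TTheory GRing.Theory Num.Theory.
Local Open Scope classical_set_scope.
Local Open Scope ring_scope.
Set Implicit Arguments.
Unset Strict Implicit.
Unset Printing Implicit Defensive.

Lemma enorm_ge0 (R : realType) (m n : nat) (Y : 'I_n -> 'cV[R]_m) :
  0 <= enorm Y.
Proof. exact: sqrtr_ge0. Qed.

Lemma enorm_sqr (R : realType) (m n : nat) (Y : 'I_n -> 'cV[R]_m) :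
  enorm Y ^+ 2 = \sum_(i < n) \sum_(j < m) (Y i j 0) ^+ 2.
Proof.
rewrite sqr_sqrtr // sumr_ge0 // => i _.
by rewrite sumr_ge0 // => j _; rewrite sqr_ge0.
Qed.

Lemma enorm_le_sqr (R : realType) (m n : nat) (Y Z : 'I_n -> 'cV[R]_m) :
  (enorm Y ^+ 2 <= enorm Z ^+ 2) = (enorm Y <= enorm Z).
Proof. by rewrite ler_sqr ?nnegrE ?enorm_ge0. Qed.

(** By cyclicity of the trace, each sample [y] contributes tr(g^T g y y^T) = (g y)^T (g y), the
    squared Euclidean length of g y. *)
Lemma mxtrace_gram_sample_cov (R : realType) (m n : nat) (g : 'M[R]_m)
    (Y : 'I_n -> 'cV[R]_m) :
  \tr (g^T *m g *m sample_cov Y) = enorm (act g Y) ^+ 2 / n%:R.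
Proof.
rewrite enorm_sqr /sample_cov -scalemxAr mxtraceZ mulrC; congr (_ * _).
rewrite mulmx_sumr raddf_sum; apply: eq_bigr => i _ /=.
rewrite -mulmxA mxtrace_mulC mulmxA -mulmxA -trmx_mul mxtrace_mulC.
rewrite /mxtrace big_ord1 mxE; apply: eq_bigr => j _.
by rewrite mxE expr2.
Qed.

(** This is [outer_fun] before the infimum over [h] is taken. *)
Definition neg_loglik (R : realType) (m n : nat) (Y : 'I_n -> 'cV[R]_m)
    (l : R) (h : 'M[R]_m) : R :=
  l / n%:R * enorm (act h Y) ^+ 2 - m%:R * ln l.

Lemma loglik_scaled_gram (R : realType) (m n : nat) (G : set 'M[R]_m)
    (Y : 'I_n -> 'cV[R]_m) (l : R) (h : 'M[R]_m) :
  0 < l -> SLpm G h -> loglik Y (l *: (h^T *m h)) = - neg_loglik Y l h.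
Proof.
move=> l0 [_ deth]; rewrite /loglik /neg_loglik -scalemxAl mxtraceZ.
rewrite mxtrace_gram_sample_cov detZ det_mulmx det_tr.
have -> : \det h * \det h = 1 by case: deth => ->; rewrite ?mulrNN mulr1.
by rewrite mulr1 lnXn // opprB mulr_natl -mulrA [_^-1 * _]mulrC.
Qed.

Lemma group_modelP (R : realType) (m : nat) (G : set 'M[R]_m) :
  is_subgroup_GL G -> closed_nonzero_scaling G ->
  forall Psi, group_model G Psi <->
    exists l h, [/\ 0 < l, SLpm G h & Psi = l *: (h^T *m h)].
Proof.
move=> subG scalG Psi; split=> [[g Gg <-]|[l [h [l0 [Gh _] ->]]]]; last first.
  exists (Num.sqrt l *: h); first by apply: scalG; rewrite // gt_eqF ?sqrtr_gt0.
  by rewrite [(_ *: _)^T]linearZ /= -scalemxAl -scalemxAr scalerA -expr2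
    sqr_sqrtr ?ltW.
have detg : 0 < `|\det g|.
  by rewrite normr_gt0 -unitfE -/(g \in unitmx); apply: subGL_unit Gg.
have [c c0 cm] : exists2 c : R, 0 < c & c ^+ m = `|\det g|.
  (* For [m = 0] the exponent 1/m is meaningless, but the empty determinant is 1, so [c = 1]
     works. *)
  case: (posnP m) => [m0|m0].
    exists 1 => //; rewrite expr1n; subst m.
    by rewrite det_mx00 normr1.
  exists (`|\det g| `^ m%:R^-1); first exact: powR_gt0.
  rewrite -powR_mulrn ?powR_ge0 // -powRrM mulVf ?powRr1 //.
  by rewrite pnatr_eq0 -lt0n.
have cu : c != 0 by rewrite gt_eqF.
(* The determinant of g/c is det g / |det g|, a sign, and the factor c^2 restores g^T g. *)
exists (c ^+ 2), (c^-1 *: g); split; first exact: exprn_gt0.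
  split; first by apply: scalG; rewrite ?invr_eq0.
  rewrite detZ exprVn cm; case: (ler0P (\det g)) detg => // _.
    by move=> ?; right; rewrite invrN mulNr mulVf // -oppr_eq0 gt_eqF.
  by move=> ?; left; rewrite mulVf // gt_eqF.
rewrite [(_ *: _)^T]linearZ /= -scalemxAl -scalemxAr !scalerA.
by rewrite -mulrA -expr2 exprVn mulfV ?scale1r // expf_neq0.
Qed.

Section profile.
Variables (R : realType) (m n : nat) (G : set 'M[R]_m) (Y : 'I_n -> 'cV[R]_m).
Hypotheses (n_gt0 : (0 < n)%N) (subG : is_subgroup_GL G).

Lemma SLpm1 : SLpm G 1%:M.
Proof. by split; [exact: subGL_1 | left; exact: det1]. Qed.

Lemma inf_SLpm_norm2_le (h : 'M[R]_m) :
  SLpm G h -> inf_SLpm_norm2 G Y <= enorm (act h Y) ^+ 2.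
Proof.
move=> Gh; apply: ge_inf; last by exists h.
by exists 0 => _ [k _ <-]; exact: sqr_ge0.
Qed.

Lemma le_inf_SLpm_norm2 (x : R) :
  (forall h, SLpm G h -> x <= enorm (act h Y) ^+ 2) ->
  x <= inf_SLpm_norm2 G Y.
Proof.
move=> lex; apply: lb_le_inf.
  by exists (enorm (act 1%:M Y) ^+ 2), 1%:M => //; exact: SLpm1.
by move=> _ [h Gh <-]; exact: lex.
Qed.

Lemma inf_SLpm_norm2_minimizer (h : 'M[R]_m) :
  is_minimizer (SLpm G) (fun h => enorm (act h Y)) h ->
  inf_SLpm_norm2 G Y = enorm (act h Y) ^+ 2.
Proof.
move=> [Gh minh]; apply/eqP; rewrite eq_le inf_SLpm_norm2_le //=.
by apply: le_inf_SLpm_norm2 => k Gk; rewrite enorm_le_sqr minh.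
Qed.

Lemma outer_fun_le (l : R) (h : 'M[R]_m) :
  0 < l -> SLpm G h -> outer_fun G Y l <= neg_loglik Y l h.
Proof.
move=> l0 Gh; rewrite lerB // ler_wpM2l ?inf_SLpm_norm2_le //.
by rewrite divr_ge0 // ltW.
Qed.

(** For fixed [l], the map t |-> (l/n) t - m ln l is affine with positive slope, so the bound can be
    solved for the squared norm and passed to the infimum. *)
Lemma le_outer_fun (l x : R) : 0 < l ->
  (forall h, SLpm G h -> x <= neg_loglik Y l h) -> x <= outer_fun G Y l.
Proof.
move=> l0 lex; have ln0 : 0 < l / n%:R by rewrite divr_gt0 ?ltr0n.
rewrite lerBrDr -ler_pdivrMl //; apply: le_inf_SLpm_norm2 => h Gh.
by rewrite ler_pdivrMl // -lerBrDr lex.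
Qed.

End profile.

(** Positivity of [m] keeps the logarithmic term: for m = 0 the function vanishes identically and
    every positive [l] minimizes it. *)
Lemma outer_fun_minimizer_unique (R : realType) (m n : nat)
    (G : set 'M[R]_m) (Y : 'I_n -> 'cV[R]_m) (l1 l2 : R) : (0 < m)%N ->
  is_minimizer [set l : R | 0 < l] (outer_fun G Y) l1 ->
  is_minimizer [set l : R | 0 < l] (outer_fun G Y) l2 -> l1 = l2.
Proof.
move=> m0 [/= p1 min1] [/= p2 min2]; apply/eqP/contraT => l12.
(* By strict concavity of [ln], the midpoint would do strictly better. *)
pose l := (l1 + l2) / 2.
have l0 : 0 < l by rewrite /l; lra.
have lnl : ln l1 + ln l2 < ln l + ln l.
  (* What remains is l1 l2 < l^2, the strict inequality of arithmetic and geometric means. *)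
  rewrite -!lnM ?posrE // ltr_ln ?posrE ?mulr_gt0 ?addr_gt0 //.
  have : 0 < (l1 - l2) ^+ 2 by rewrite exprn_even_gt0 //= subr_eq0.
  by rewrite /l; nra.
have : m%:R * (ln l1 + ln l2) < m%:R * (ln l + ln l) by rewrite ltr_pM2l ?ltr0n.
have := min1 l l0; have := min2 l l0; rewrite /outer_fun.
set a := inf_SLpm_norm2 G Y => le2 le1; rewrite !mulrDr => ltm.
have : l / n%:R * a + l / n%:R * a = l1 / n%:R * a + l2 / n%:R * a.
  by rewrite -!mulrDl; congr (_ * _ * _); rewrite /l; lra.
by lra.
Qed.

Theorem proposition3p4 (R : realType) (m n : nat) (G : set 'M[R]_m)
    (Y : 'I_n -> 'cV[R]_m)
    (n_gt0 : (0 < n)%N)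
    (subgroupG : is_subgroup_GL G)
    (scalG : closed_nonzero_scaling G) :
  [/\ ereal_sup [set (loglik Y Psi)%:E | Psi in group_model G] =
        (- ereal_inf [set (outer_fun G Y l)%:E | l in [set l : R | (0 < l)%R]])%E,
      forall Psi : 'M[R]_m,
        is_MLE G Y Psi <->
        exists l : R, exists h : 'M[R]_m,
          [/\ is_minimizer [set l : R | 0 < l] (outer_fun G Y) l,
              is_minimizer (SLpm G) (fun h => enorm (act h Y)) h &
              Psi = l *: (h^T *m h)] &
      (0 < m)%N -> (exists Psi : 'M[R]_m, is_MLE G Y Psi) ->
        exists! l : R, is_minimizer [set l : R | 0 < l] (outer_fun G Y) l].
Proof.
have modelP := group_modelP subgroupG scalG.
have model l h : 0 < l -> SLpm G h -> group_model G (l *: (h^T *m h)).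
  by move=> l0 Gh; apply/modelP; exists l, h.
have MLEP Psi : is_MLE G Y Psi <-> exists l h,
    [/\ is_minimizer [set l : R | 0 < l] (outer_fun G Y) l,
        is_minimizer (SLpm G) (fun h => enorm (act h Y)) h &
        Psi = l *: (h^T *m h)].
  split=> [[/modelP[l [h [l0 Gh ->]]] maxPsi]|[l [h [[/= l0 minl] minh ->]]]].
    (* An MLE is a joint minimizer over pairs: varying [g] at k = l shows that [h] is optimal, then
       varying [k] at g = h shows that [l] is. *)
    have minF k g : 0 < k -> SLpm G g -> neg_loglik Y l h <= neg_loglik Y k g.
      move=> k0 Gg; rewrite -lerN2 -!(loglik_scaled_gram (G := G)) //.
      exact/maxPsi/model.
    have minh : is_minimizer (SLpm G) (fun h => enorm (act h Y)) h.
      split=> // g Gg; rewrite -enorm_le_sqr; have := minF l g l0 Gg.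
      by rewrite lerD2r ler_pM2l // divr_gt0 ?ltr0n.
    exists l, h; split=> //; split=> //= k k0.
    rewrite /outer_fun (inf_SLpm_norm2_minimizer subgroupG minh).
    exact: minF.
  have [Gh _] := minh; split; first exact: model.
  move=> _ /modelP[k [g [k0 Gg ->]]].
  rewrite !(loglik_scaled_gram (G := G)) // lerN2.
  (* The chain is neg_loglik(l, h) = outer_fun(l) <= outer_fun(k) <= neg_loglik(k, g), with equality
     at the start because [h] attains the inner infimum. *)
  apply: le_trans (outer_fun_le Y k0 Gg); apply: le_trans (minl k k0).
  by rewrite /outer_fun (inf_SLpm_norm2_minimizer subgroupG minh).
split=> [|//|m0 [Psi /MLEP[l [h [minl _ _]]]]]; last first.
  by exists l; split=> // k; exact: outer_fun_minimizer_unique minl.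
apply/eqP; rewrite eq_le; apply/andP; split.
  apply: ge_ereal_sup => _ [_ /modelP[l [h [l0 Gh ->]]] <-].
  rewrite (loglik_scaled_gram (G := G)) // EFinN leeN2.
  apply: (@le_trans _ _ (outer_fun G Y l)%:E); last first.
    by rewrite lee_fin outer_fun_le.
  by apply: ereal_inf_lbound; exists l.
rewrite leeNl; apply: le_ereal_inf_tmp => _ [l /= l0 <-].
set S := ereal_sup _.
have leS h : SLpm G h -> ((- neg_loglik Y l h)%:E <= S)%E.
  move=> Gh; apply: ereal_sup_ubound; exists (l *: (h^T *m h)).
    exact: model.
  by rewrite (loglik_scaled_gram (G := G)).
(* If the supremum is +oo, the left side is -oo; it cannot be -oo, since the identity matrix gives a
   real value below it. *)
case: S leS => [s| |] leS; last 2 first.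
- by rewrite leNye.
- by have := leS _ (SLpm1 subgroupG).
rewrite -EFinN lee_fin; apply: le_outer_fun => // h Gh.
by rewrite lerNl -lee_fin leS.
Qed.
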